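(* Let $(V,E)$ be a connected graph, let $\mathcal{M}^I\subseteq V$, $\mathcal{M}^L\subseteq E$, $\mathcal{M}^P\subseteq V$, and let real costs $c^I_i$ ($i\in\mathcal{M}^I$), $c^L_j$ ($j\in\mathcal{M}^L$), $c^P_k$ ($k\in\mathcal{M}^P$) be given. Then the integer program (IP) defined in the context is equivalent to the mixed integer linear program (MIP) obtained from it by relaxing the variables $x,y,w,u$ to be continuous, namely $0\le x_i\le1$ for $i\in\mathcal{M}^I$, $0\le y_j\le1$ for $j\in\mathcal{M}^L$, $0\le w_{ei}\le1$ for $(e,i)\in E\times V$, and $0\le u_i\le|V|$ for $i\in V\cup\{0\}$, while keeping $z_k\in\{0,1\}$ for $k\in\mathcal{M}^P$ and all $f_{ij}\in\{0,1\}$ and all other constraints: (IP) is feasible if and only if (MIP) is feasible, and the two programs have the same optimal value.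
   Context: Graphs are finite and undirected; edges are unordered pairs of two nodes. Let $0$ be an additional node not in $V$, and put $\bar V=V\cup\{0\}$, $\bar E=E\cup\{\{i,0\}\mid i\in V\}$, $\bar{\mathcal{A}}=\{(i,j),(j,i)\mid\{i,j\}\in\bar E\}$. Integer program (IP): minimize $\sum_{i\in\mathcal{M}^I}c^I_ix_i+\sum_{j\in\mathcal{M}^L}c^L_jy_j+\sum_{k\in\mathcal{M}^P}c^P_kz_k$ over $x_i$ ($i\in V$), $y_j$ ($j\in E$), $z_k$ ($k\in V$), $w_{ei}$ ($(e,i)\in E\times V$), $f_{ij}$ ($(i,j)\in\bar{\mathcal{A}}$), $u_i$ ($i\in\bar V$), subject to: 1. $(|\bar V|-1)f_{ij}+(|\bar V|-3)f_{ji}+u_i-u_j\le|\bar V|-2$ for all $(i,j)\in\bar{\mathcal{A}}$; 2. $0\le u_i\le|\bar V|-1$ for all $i\in\bar V$; 3. $\sum_{j:(i,j)\in\bar{\mathcal{A}}}f_{ij}=1$ for all $i\in\bar V\setminus\{0\}$; 4. $\sum_{j:(j,0)\in\bar{\mathcal{A}}}f_{j0}\ge1$; 5. $\sum_{(i,j)\in\bar{\mathcal{A}}}f_{ij}=|\bar V|-1$; 6. $f_{0i}+f_{i0}\le z_i+\sum_{j:\{i,j\}\in E}z_j$ for all $i\in V$; 7. $f_{ij}+f_{ji}\le y_{\{i,j\}}+w_{\{i,j\}i}+w_{\{i,j\}j}$ for all $\{i,j\}\in E$; 8. $w_{ei}=0$ whenever $i\notin e$, and $\sum_{e\in E}w_{ei}\le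 x_i$ for all $i\in V$; 9. $x_i=0$ for $i\notin\mathcal{M}^I$, $y_j=0$ for $j\notin\mathcal{M}^L$, $z_k=0$ for $k\notin\mathcal{M}^P$; 10. $x_i\in\{0,1\}$ for $i\in\mathcal{M}^I$, $y_j\in\{0,1\}$ for $j\in\mathcal{M}^L$, $z_k\in\{0,1\}$ for $k\in\mathcal{M}^P$, $w_{ei}\in\{0,1\}$ for $(e,i)\in E\times V$, $f_{ij}\in\{0,1\}$ for $(i,j)\in\bar{\mathcal{A}}$, $u_i\in\{0,1,\ldots,|V|\}$ for $i\in\bar V$. *)

(* Defs.v *)
From HB Require Import structures.
From mathcomp Require Import all_boot all_order all_algebra.
From mathcomp Require Import classical_sets reals ereal.

Set Implicit Arguments.
Unset Strict Implicit.
Unset Printing Implicit Defensive.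

Import Order.TTheory GRing.Theory Num.Theory.

Local Open Scope ring_scope.

Section Graph.
Variable V : finType.
Implicit Type E : {set {set V}}.

(* A finite simple graph on V is given by its edge set E, a set of unordered
   pairs of distinct nodes. *)
Definition simple_graph E : Prop := forall e, e \in E -> #|e| = 2%N.

Definition adj E : rel V := [rel i j | [set i; j]%SET \in E].

Definition connected_graph E : Prop :=
  simple_graph E /\ forall i j : V, connect (adj E) i j.

(* The additional node 0 is [None : option V]; [Some i] is the node i of V. *)
Definition bar_edges E : {set {set option V}} :=
  ([set [set Some i | i in e] | e : {set V} in E]
     :|: [set [set Some i; None] | i : V])%SET.

Definition bar_arcs E : {set option V * option V} :=
  [set a : option V * option V | [set a.1; a.2] \in bar_edges E]%SET.

End Graph.

Section Programs.
Variables (R : realType) (V : finType).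

(* Only the coordinates indexed as in the program matter: var_y e and var_w e i
   for e an edge, and var_f i j for (i, j) an arc.  The other coordinates occur
   neither in the constraints nor in the objective. *)
Record point := Point {
  var_x : V -> R;
  var_y : {set V} -> R;
  var_z : V -> R;
  var_w : {set V} -> V -> R;
  var_f : option V -> option V -> R;
  var_u : option V -> R
}.

Variables (E : {set {set V}}) (MI : {set V}) (ML : {set {set V}})
  (MP : {set V}) (cI : V -> R) (cL : {set V} -> R) (cP : V -> R).

Definition objective (s : point) : R :=
  \sum_(i in MI) cI i * var_x s i
  + \sum_(e in ML) cL e * var_y s e
  + \sum_(k in MP) cP k * var_z s k.

(* The real number |V \cup {0}|; it is only ever decreased inside R, since
   |V \cup {0}| - 3 is negative when V has one node. *)
Definition bar_card : R := #|{: option V}|%:R.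

Definition common_constraints (s : point) : Prop :=
  let: Point x y z w f u := s in
  [/\ [/\ (forall i j, (i, j) \in bar_arcs E ->
             (bar_card - 1) * f i j + (bar_card - 3) * f j i + u i - u j
               <= bar_card - 2),
          (forall i, 0 <= u i <= bar_card - 1),
          (forall i, i != None -> \sum_(j | (i, j) \in bar_arcs E) f i j = 1),
          1 <= \sum_(j | (j, None) \in bar_arcs E) f j None
        & \sum_(a in bar_arcs E) f a.1 a.2 = bar_card - 1],
      [/\ (forall i : V, f None (Some i) + f (Some i) None
             <= z i + \sum_(j | [set i; j]%SET \in E) z j),
          (forall i j : V, [set i; j]%SET \in E ->
             f (Some i) (Some j) + f (Some j) (Some i)
               <= y [set i; j]%SET + w [set i; j]%SET i + w [set i; j]%SET j),
          (forall e i, e \in E -> i \notin e -> w e i = 0)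
        & (forall i, \sum_(e in E) w e i <= x i)]
    & [/\ (forall i, i \notin MI -> x i = 0),
          (forall e, e \in E -> e \notin ML -> y e = 0)
        & (forall k, k \notin MP -> z k = 0)]].

Definition binary (t : R) : Prop := t = 0 \/ t = 1.

Definition IP_domains (s : point) : Prop :=
  let: Point x y z w f u := s in
  [/\ [/\ (forall i, i \in MI -> binary (x i)),
          (forall e, e \in ML -> binary (y e))
        & (forall k, k \in MP -> binary (z k))],
      (forall e i, e \in E -> binary (w e i)),
      (forall i j, (i, j) \in bar_arcs E -> binary (f i j))
    & (forall i, exists2 n : nat, (n <= #|V|)%N & u i = n%:R)].

Definition MIP_domains (s : point) : Prop :=
  let: Point x y z w f u := s in
  [/\ [/\ (forall i, i \in MI -> 0 <= x i <= 1),
          (forall e, e \in ML -> 0 <= y e <= 1)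
        & (forall k, k \in MP -> binary (z k))],
      (forall e i, e \in E -> 0 <= w e i <= 1),
      (forall i j, (i, j) \in bar_arcs E -> binary (f i j))
    & (forall i, 0 <= u i <= #|V|%:R)].

Definition IP_feasible : set point :=
  [set s | common_constraints s /\ IP_domains s]%classic.

Definition MIP_feasible : set point :=
  [set s | common_constraints s /\ MIP_domains s]%classic.

(* Optimal value of minimizing the objective over S, in the extended reals:
   +oo when S is empty, -oo when the objective is unbounded below on S. *)
Definition optimal_value (S : set point) : \bar R :=
  ereal_inf [set (objective s)%:E | s in S]%classic.

End Programs.

Arguments IP_feasible R {V} E MI ML MP.
Arguments MIP_feasible R {V} E MI ML MP.

(* Main.v *)
Require Import Defs.
From HB Require Import structures.
From mathcomp Require Import all_boot all_order all_algebra.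
From mathcomp Require Import lra zify.
From mathcomp Require Import classical_sets reals ereal.

Set Implicit Arguments.
Unset Strict Implicit.
Unset Printing Implicit Defensive.

Import Order.TTheory GRing.Theory Num.Theory.

Local Open Scope ring_scope.

(** Every binary point is feasible for the relaxation, so all that is needed is
    that a feasible point (x, y, z, w, f, u) of the relaxation can be turned
    into a feasible point of the integer program that costs no more.  The
    binary variables z and f are kept, and the other variables then split into
    two independent groups.

    The variables u occur only in difference constraints u_i - u_j <= b, whose
    right-hand side b is an integer because f is binary.  Taking the floor of
    each u_i preserves such constraints (floor_difference) and the bounds.

    The variables x, y, w with f fixed form a network flow problem: x_i units
    enter node i from a root, are sent on to the edges e in the amounts w_ei,
    and each edge e also receives y_e units directly from the root; what is
    not used flows back to the root.  The only other requirement is that edge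
    e gets at least f_ij + f_ji units, an integer.  A flow whose divergences
    are integers can be rounded to an integral flow of at most the same cost
    in which every value stays between the floor and the ceiling of the
    original one (integral_flow).  This keeps the zero values that the
    constraints prescribe, the bounds 0 and 1, and the integer demands of the
    edges (integral_assignment).

    The integrality of flows is proved by induction on the number of arcs with
    a fractional value.  A node that meets one fractional arc meets a second
    one, since its divergence is an integer (degree_fractional).  Hence there
    are at least as many fractional arcs as nodes that they meet, whereas the
    incidence matrix of these arcs and nodes has dependent columns, so that
    its rank is smaller than the number of arcs and a nonzero circulation
    lives on the fractional arcs (circulation_of_degree).  The flow is moved
    along it, in the direction that does not increase the cost, until some
    fractional value becomes an integer (push_circulation). *)

(** * Integrality of network flows *)

(** The integer bounds of r are kept by s: s lies between the floor and the
    ceiling of r.  The number s may be fractional, so that the relation can be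
    composed along a sequence of partial roundings. *)
Definition rounds (R : archiRealFieldType) (r s : R) : Prop :=
  forall k : R, k \is a Num.int -> (k <= r -> k <= s) /\ (r <= k -> s <= k).

Section NetworkFlow.
Variables (R : archiRealFieldType) (A N : finType) (tail head : A -> N).
Implicit Types (f g c : A -> R) (a b : A) (v : N) (F : {set A}).

Definition incidence a v : R := (tail a == v)%:R - (head a == v)%:R.

Definition divergence f v : R := \sum_a f a * incidence a v.

Definition incident a v : bool := (tail a == v) || (head a == v).

(** A loop counts twice, as in the handshake formula. *)
Definition degree F v : nat :=
  (\sum_(a in F) ((tail a == v) + (head a == v)))%N.

Definition fractional f : {set A} := [set a | f a \isn't a Num.int]%SET.


Lemma incidence0 a v : ~~ incident a v -> incidence a v = 0.
Proof. by rewrite /incidence negb_or => /andP[/negPf-> /negPf->]; rewrite subrr. Qed.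

Lemma sum_incidence (W : {set N}) a :
  tail a \in W -> head a \in W -> \sum_(v in W) incidence a v = 0.
Proof.
move=> tW hW; rewrite sumrB.
suff one u : u \in W -> \sum_(v in W) (u == v)%:R = 1 :> R by rewrite !one ?subrr.
move=> uW; rewrite (bigD1 u) //= eqxx big1 ?addr0 // => v /andP[_ vu].
by rewrite eq_sym (negPf vu).
Qed.

(** Each arc leaves one node and enters one node.  This gives the
    integrality of the divergence at a root from that at all other nodes. *)
Lemma sum_divergence f : \sum_v divergence f v = 0.
Proof.
rewrite exchange_big big1 // => a _; rewrite -mulr_sumr.
rewrite (eq_bigl (fun v => v \in [set: N]%SET)); last by move=> v; rewrite inE.
by rewrite sum_incidence ?mulr0 ?inE.
Qed.

(** If a were the only fractional arc at v, and not a loop, the divergence at v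
    would be f a or - f a up to an integer. *)
Lemma degree_fractional f a v :
    divergence f v \is a Num.int -> a \in fractional f -> incident a v ->
  (2 <= degree (fractional f) v)%N.
Proof.
move=> intdiv aF av; rewrite leqNgt; apply/negP.
rewrite /degree (bigD1 a) //= => small.
have intF b : b \notin fractional f -> f b \is a Num.int by rewrite inE negbK.
have rest b : b != a -> f b * incidence b v \is a Num.int.
  move=> ba; have [bF|/intF fb] := boolP (b \in fractional f); last first.
    by rewrite rpredM // /incidence rpredB // natr_int.
  rewrite incidence0 ?mulr0 ?rpred0 //; apply/negP=> bv; move: small.
  rewrite (bigD1 b) /=; last by rewrite bF ba.
  move: av bv; rewrite /incident.
  by case: (tail a == v); case: (head a == v); case: (tail b == v);
     case: (head b == v).
have: f a * incidence a v \is a Num.int.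
  move: intdiv; rewrite /divergence (bigD1 a) //= rpredDr //.
  by apply: rpred_sum => b; apply: rest.
move: small av; rewrite /incident /incidence.
case: (tail a == v); case: (head a == v) => //= _ _.
  by rewrite subr0 mulr1; move: aF; rewrite inE => /negPf->.
by rewrite sub0r mulrN mulr1 rpredN; move: aF; rewrite inE => /negPf->.
Qed.

(** Let W be the set of nodes that F meets.  Counting incidences gives
    2 |W| <= 2 |F|.  The incidence matrix M of F against W has columns that
    sum to zero, so rank M < |W| <= |F|, and M has a nonzero left kernel,
    whose elements are the circulations supported on F. *)
Lemma circulation_of_degree F a0 : a0 \in F ->
    (forall a v, a \in F -> incident a v -> (2 <= degree F v)%N) ->
  exists d : A -> R, [/\ exists a, d a != 0, forall a, a \notin F -> d a = 0
    & forall v, divergence d v = 0].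
Proof.
move=> a0F deg2; pose W := [set v | [exists a in F, incident a v]]%SET.
have tW a : a \in F -> tail a \in W.
  by move=> aF; rewrite inE; apply/exists_inP; exists a; rewrite /incident ?eqxx.
have hW a : a \in F -> head a \in W.
  move=> aF; rewrite inE; apply/exists_inP; exists a => //.
  by rewrite /incident eqxx orbT.
have leWF : (#|W| <= #|F|)%N.
  rewrite -(leq_pmul2r (isT : 0 < 2)%N).
  have : (\sum_(v in W) 2 <= \sum_(v in W) degree F v)%N.
    apply: leq_sum => v; rewrite inE => /exists_inP[a aF av].
    exact: (deg2 a).
  rewrite sum_nat_const => /leq_trans-> //.
  rewrite exchange_big /= -sum_nat_const; apply: leq_sum => a aF.
  rewrite big_split /=.
  have one u : (\sum_(v in W) (u == v) <= 1)%N.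
    rewrite -big_mkcondr /=.
    apply: leq_trans (_ : \sum_(v | u == v) 1 <= _)%N.
      rewrite [X in (X <= _)%N]big_mkcond [X in (_ <= X)%N]big_mkcond /=.
      by apply: leq_sum => v _; do 2!case: ifP => //; rewrite ?andbF //; case/andP.
    by rewrite sum1_card (eq_card1 (x := u)) // => v; rewrite inE eq_sym.
  by rewrite -[2%N]/(1 + 1)%N leq_add.
pose M := \matrix_(p < #|F|, q < #|W|) incidence (enum_val p) (enum_val q).
have M1 : M *m const_mx 1 = 0 :> 'cV_#|F|.
  apply/matrixP=> p j; rewrite !mxE.
  under eq_bigr do rewrite !mxE mulr1.
  have pF := enum_valP p.
  by rewrite -[RHS](sum_incidence (tW _ pF) (hW _ pF)) [RHS]big_enum_val.
have rkM : (\rank M < #|F|)%N.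
  apply: leq_trans leWF; rewrite ltn_neqAle rank_leq_col andbT.
  apply/negP=> /row_fullP[B BM].
  have := congr1 (mulmx B) M1; rewrite mulmx0 mulmxA BM mul1mx.
  move/matrixP/(_ (enum_rank_in (tW _ a0F) (tail a0)) 0); rewrite !mxE.
  by move/eqP; rewrite oner_eq0.
have : kermx M != 0 by rewrite kermx_eq0 /row_free neq_ltn rkM.
case/rowV0Pn => x /sub_kermxP xM x0.
have [p xp] : exists p, x 0 p != 0.
  apply/existsP; apply: contraNT x0; rewrite negb_exists => /forallP x0.
  by apply/eqP/rowP=> p; rewrite mxE; apply/eqP; rewrite -[_ == _]negbK x0.
pose h := enum_rank_in a0F.
exists (fun a => if a \in F then x 0 (h a) else 0); split.
- by exists (enum_val p); rewrite enum_valP /h enum_valK_in.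
- by move=> a /negPf->.
move=> v; rewrite /divergence.
have -> : \sum_a (if a \in F then x 0 (h a) else 0) * incidence a v =
          \sum_p x 0 p * incidence (enum_val p) v.
  rewrite (big_enum_rank a0F) /= [RHS]big_mkcond /=; apply: eq_bigr => a _.
  by case: ifP => aF; rewrite ?mul0r // enum_rankK_in.
have [vW|vW] := boolP (v \in W); last first.
  rewrite big1 // => q _; rewrite incidence0 ?mulr0 //; apply: contra vW => qv.
  by rewrite inE; apply/exists_inP; exists (enum_val q); rewrite ?enum_valP.
have /matrixP/(_ 0 (enum_rank_in vW v)) := xM; rewrite !mxE => {2}<-.
by apply: eq_bigr => q _; rewrite mxE enum_rankK_in.
Qed.

Lemma divergenceD f g (t : R) v :
  divergence (fun a => f a + t * g a) v = divergence f v + t * divergence g v.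
Proof.
rewrite mulr_sumr -big_split; apply: eq_bigr => a _.
by rewrite mulrDl mulrA.
Qed.

(** Moving by t d with t >= 0 brings each value with d a <> 0 towards one of
    its two neighbouring integers, and reaches it at t = T a.  The step is the
    smallest T a: no value passes its integer, and one value attains it. *)
Lemma push_circulation f c (d : A -> R) :
    (exists a, d a != 0) -> (forall a, a \notin fractional f -> d a = 0) ->
    (forall v, divergence d v = 0) ->
  exists g, [/\ forall a, rounds (f a) (g a), forall v, divergence g v = divergence f v,
    \sum_a c a * g a <= \sum_a c a * f a
    & (#|fractional g| < #|fractional f|)%N].
Proof.
(* Either d or - d does not increase the cost. *)
wlog cd : d / \sum_a c a * d a <= 0.
  move=> wl d0 dF divd; have [/wl|cd] := leP (\sum_a c a * d a) 0; first exact.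
  apply: (wl (fun a => - d a)).
  - by under eq_bigr do rewrite mulrN; rewrite sumrN oppr_le0 ltW.
  - by case: d0 => a da; exists a; rewrite oppr_eq0.
  - by move=> a /dF->; rewrite oppr0.
  by move=> v; rewrite /divergence; under eq_bigr do rewrite mulNr;
     rewrite sumrN -/(divergence d v) divd oppr0.
move=> [a0 da0] dF divd.
pose bd a : R := (if 0 < d a then Num.ceil (f a) else Num.floor (f a))%:~R.
pose T a := (bd a - f a) / d a.
have T0 a : d a != 0 -> 0 <= T a.
  rewrite /T /bd; case: (ltgtP (d a) 0) => // [dn|dp] _.
    by rewrite ler_ndivlMr // mul0r subr_le0 floor_le.
  by rewrite ler_pdivlMr // mul0r subr_ge0 ceil_ge.
case: (@arg_minP _ _ _ a0 (fun a => d a != 0) T da0) => a1 da1 Tmin.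
set t := T a1 in Tmin; have t0 : 0 <= t by exact: T0.
pose g a := f a + t * d a.
have Rfg a : rounds (f a) (g a).
  move=> k kint; rewrite /g; have [->|da] := eqVneq (d a) 0.
    by rewrite mulr0 addr0.
  have := Tmin a da; rewrite /T /bd => tT.
  case: (ltgtP (d a) 0) da tT => // [dn|dp] _ tT.
    have bdle : (Num.floor (f a))%:~R <= f a + t * d a.
      by move: tT; rewrite ler_ndivlMr // => ?; lra.
    split=> [kf|]; last first.
      by apply: le_trans; rewrite gerDl mulr_ge0_le0 // ltW.
    apply: le_trans bdle; case/intrP: kint kf => m ->.
    by rewrite -floor_ge_int ler_int.
  have bdge : f a + t * d a <= (Num.ceil (f a))%:~R.
    by move: tT; rewrite ler_pdivlMr // => ?; lra.
  split=> [|kf]; first by move/le_trans; apply; rewrite lerDl mulr_ge0 // ltW.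
  apply: le_trans bdge _; case/intrP: kint kf => m ->.
  by rewrite -ceil_le_int ler_int.
exists g; split=> //.
- by move=> v; rewrite divergenceD divd mulr0 addr0.
- have -> : \sum_a c a * g a = \sum_a c a * f a + t * \sum_a c a * d a.
    rewrite mulr_sumr -big_split; apply: eq_bigr => a _ /=.
    by rewrite mulrDr mulrCA.
  by rewrite gerDl mulr_ge0_le0.
apply/proper_card/properP; split.
  apply/fintype.subsetP => a; apply: contraLR => aF.
  by move: (aF); rewrite !inE !negbK /g dF // mulr0 addr0.
exists a1; first by apply: contraNT da1 => /dF->.
rewrite inE negbK /g /t /T divfK // addrC subrK /bd.
exact: intr_int.
Qed.

Theorem integral_flow f c :
    (forall v, divergence f v \is a Num.int) ->
  exists g, [/\ forall a, g a \is a Num.int, forall a, rounds (f a) (g a),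
    forall v, divergence g v = divergence f v
    & \sum_a c a * g a <= \sum_a c a * f a].
Proof.
have [n] := ubnP #|fractional f|; elim: n f => // n IH f; rewrite ltnS => lefn intdiv.
have [F0|[a0 a0F]] := set_0Vmem (fractional f).
  exists f; split=> // a; apply: negbNE.
  by have := finset.in_set0 a; rewrite -F0 inE => ->.
have [d [d0 dF divd]] := circulation_of_degree a0F
  (fun a v aF av => degree_fractional (intdiv v) aF av).
have [g [Rfg divg cg gF]] := push_circulation c d0 dF divd.
have [v|h [inth Rgh divh ch]] := IH g (leq_trans gF lefn); first by rewrite divg.
exists h; split=> // [a k kint|v|].
- have [kf fk] := Rfg a k kint; have [kg gk] := Rgh a k kint.
  by split=> [/kf/kg|/fk/gk].
- by rewrite divh.
exact: le_trans cg.
Qed.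

End NetworkFlow.

(** * Serving the edges from their nodes as a flow problem *)

Section Assignment.
Variables (R : archiRealFieldType) (V : finType) (E : {set {set V}}).

(** The network has a root None, the nodes Some (inl i) of the graph and one
    node Some (inr e) for each set e of nodes.  The five kinds of arcs carry
    x, the slack of the capacity constraint of i, y, the slack of the demand
    of e, and w. *)
Definition arc : finType :=
  ((V + V) + (({set V} + {set V}) + ({set V} * V)))%type.
Definition node : finType := option (V + {set V}).

Definition install i : arc := inl (inl i).
Definition spare i : arc := inl (inr i).
Definition link e : arc := inr (inl (inl e)).
Definition excess e : arc := inr (inl (inr e)).
Definition serve e i : arc := inr (inr (e, i)).

Definition arc_tail (a : arc) : node :=
  match a with
  | inl (inl _) | inr (inl (inl _)) => None
  | inl (inr i) => Some (inl i)
  | inr (inl (inr e)) => Some (inr e)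
  | inr (inr p) => Some (inl p.2)
  end.

Definition arc_head (a : arc) : node :=
  match a with
  | inl (inl i) => Some (inl i)
  | inl (inr _) | inr (inl (inr _)) => None
  | inr (inl (inl e)) => Some (inr e)
  | inr (inr p) => Some (inr p.1)
  end.

Lemma sum_arc (F : arc -> R) :
  \sum_a F a = \sum_i F (install i) + \sum_i F (spare i)
    + (\sum_e F (link e) + \sum_e F (excess e) + \sum_e \sum_i F (serve e i)).
Proof.
rewrite !big_sumType /=; congr (_ + (_ + _)).
by rewrite pair_bigA; apply: eq_bigr => -[].
Qed.

(** The next three lemmas evaluate the part of a divergence that comes from one
    kind of arcs, in the shape in which unfolding the incidence leaves it. *)
Lemma sum_tail (T : finType) (F : T -> R) (h : T -> node) u :
  injective h -> \sum_j F j * ((h j == h u)%:R - 0) = F u.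
Proof.
move=> injh; rewrite (bigD1 u) //= eqxx subr0 mulr1 big1 ?addr0 // => j ju.
by rewrite (inj_eq injh) (negPf ju) subr0 mulr0.
Qed.

Lemma sum_head (T : finType) (F : T -> R) (h : T -> node) u :
  injective h -> \sum_j F j * (0 - (h j == h u)%:R) = - F u.
Proof.
move=> injh; rewrite -[in RHS](sum_tail F u injh) -sumrN.
by apply: eq_bigr => j _; rewrite sub0r subr0 mulrN.
Qed.

Lemma sum_away (T : finType) (F : T -> R) : \sum_j F j * (0 - 0) = 0.
Proof. by rewrite big1 // => j _; rewrite subr0 mulr0. Qed.

Lemma divergence_node (f : arc -> R) i :
  divergence arc_tail arc_head f (Some (inl i)) =
    f (spare i) + \sum_e f (serve e i) - f (install i).
Proof.
have inj_node : injective (fun j => Some (inl j) : node) by move=> j k [].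
rewrite /divergence sum_arc /incidence /=.
rewrite (sum_head _ i inj_node) (sum_tail _ i inj_node) !sum_away !add0r.
under [X in _ + X]eq_bigr do rewrite (sum_tail _ i inj_node).
by lra.
Qed.

Lemma divergence_edge (f : arc -> R) e :
  divergence arc_tail arc_head f (Some (inr e)) =
    f (excess e) - (f (link e) + \sum_i f (serve e i)).
Proof.
have inj_edge : injective (fun j => Some (inr j) : node) by move=> j k [].
rewrite /divergence sum_arc /incidence /=.
rewrite (sum_head _ e inj_edge) (sum_tail _ e inj_edge) !sum_away !add0r.
rewrite exchange_big /=.
under [X in _ + X]eq_bigr do rewrite (sum_head _ e inj_edge).
by rewrite sumrN; lra.
Qed.

(** The demand of e is the floor of its total supply y e + sum_i w e i, which
    bounds every integer that this supply bounds.  With this choice the excess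
    of e is the fractional part of the supply, all divergences are integers,
    and the rounded slacks are nonnegative because the original ones are. *)
Theorem integral_assignment (x : V -> R) (y : {set V} -> R)
    (w : {set V} -> V -> R) (cx : V -> R) (cy : {set V} -> R) :
    (forall i, \sum_(e in E) w e i <= x i) ->
  exists x' y' w', [/\
    [/\ forall i, x' i \is a Num.int, forall e, y' e \is a Num.int
      & forall e i, w' e i \is a Num.int],
    [/\ forall i, rounds (x i) (x' i), forall e, e \in E -> rounds (y e) (y' e)
      & forall e i, e \in E -> rounds (w e i) (w' e i)],
    forall i, \sum_(e in E) w' e i <= x' i,
    forall e k, e \in E -> k \is a Num.int ->
      k <= y e + \sum_i w e i -> k <= y' e + \sum_i w' e i
    & \sum_i cx i * x' i + \sum_(e in E) cy e * y' e <=
      \sum_i cx i * x i + \sum_(e in E) cy e * y e].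
Proof.
move=> load.
pose cover e := y e + \sum_i w e i.
pose f (a : arc) : R := match a with
  | inl (inl i) => x i
  | inl (inr i) => x i - \sum_(e in E) w e i
  | inr (inl (inl e)) => if e \in E then y e else 0
  | inr (inl (inr e)) =>
      if e \in E then cover e - (Num.floor (cover e))%:~R else 0
  | inr (inr p) => if p.1 \in E then w p.1 p.2 else 0
  end.
pose c (a : arc) : R := match a with
  | inl (inl i) => cx i
  | inr (inl (inl e)) => if e \in E then cy e else 0
  | _ => 0
  end.
(* Arcs at sets outside E carry no flow, hence none after rounding either. *)
have div_node i : divergence arc_tail arc_head f (Some (inl i)) = 0.
  by rewrite divergence_node /= -big_mkcond subrK subrr.
have div_edge e : divergence arc_tail arc_head f (Some (inr e)) =
    if e \in E then - (Num.floor (cover e))%:~R else 0.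
  rewrite divergence_edge /=; case: ifP => _; last by rewrite big1 // addr0 subr0.
  by rewrite -/(cover e) addrAC subrr sub0r.
have intdiv v : divergence arc_tail arc_head f v \is a Num.int.
  have intS u : divergence arc_tail arc_head f (Some u) \is a Num.int.
    case: u => [i|e]; first by rewrite div_node.
    by rewrite div_edge; case: ifP => _; rewrite ?rpredN ?intr_int.
  case: v => // ; have := sum_divergence arc_tail arc_head f.
  rewrite (bigD1 None) //= => /eqP; rewrite addr_eq0 => /eqP->.
  by rewrite rpredN rpred_sum // => -[].
have [g [intg Rfg divg cg]] := integral_flow c intdiv.
exists (fun i => g (install i)), (fun e => g (link e)), (fun e i => g (serve e i)).
have g0 a : f a = 0 -> g a = 0.
  by move=> fa; apply/le_anti; have [] := Rfg a 0 (rpred0 _);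
     rewrite fa => /(_ (lexx _))-> /(_ (lexx _))->.
split.
- by [].
- split=> [i|e eE|e i eE]; first exact: (Rfg (install i)).
    by have := Rfg (link e); rewrite /= eE.
  by have := Rfg (serve e i); rewrite /= eE.
- move=> i; have := divg (Some (inl i)); rewrite div_node divergence_node.
  have spare0 : 0 <= g (spare i).
    by apply: (Rfg (spare i) 0 (rpred0 _)).1; rewrite /= subr_ge0.
  have -> : \sum_e g (serve e i) = \sum_(e in E) g (serve e i).
    rewrite [RHS]big_mkcond; apply: eq_bigr => e _.
    by case: ifP => // eE; apply: g0; rewrite /= eE.
  by move=> ?; lra.
- move=> e k eE kint lek; have := divg (Some (inr e)).
  rewrite div_edge divergence_edge eE.
  have excess0 : 0 <= g (excess e).
    by apply: (Rfg (excess e) 0 (rpred0 _)).1; rewrite /= eE subr_ge0 floor_le.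
  have : k <= (Num.floor (cover e))%:~R.
    by case/intrP: kint lek => m ->; rewrite -floor_ge_int ler_int.
  by move=> *; lra.
have cost h : \sum_a c a * h a =
    \sum_i cx i * h (install i) + \sum_(e in E) cy e * h (link e).
  rewrite sum_arc /=; congr (_ + _).
  - by rewrite [X in _ + X]big1 ?addr0 // => i _; rewrite mul0r.
  rewrite [X in _ + X + _]big1 => [|e _]; last by rewrite mul0r.
  rewrite [X in _ + X]big1 => [|e _]; last by rewrite big1 // => i; rewrite mul0r.
  rewrite !addr0 [RHS]big_mkcond; apply: eq_bigr => e _.
  by case: ifP => // _; rewrite mul0r.
move: cg; rewrite !cost => /le_trans; apply.
by rewrite lerD2l; apply: ler_sum => e eE; rewrite /= eE.
Qed.

End Assignment.

(** * Rounding a point of the relaxation *)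

Lemma rounds_binary (R : realType) (r s : R) :
  rounds r s -> s \is a Num.int -> 0 <= r <= 1 -> binary s.
Proof.
move=> rs /intrP[m sm] /andP[/(rs 0 (rpred0 _)).1 s0 /(rs 1 (rpred1 _)).2 s1].
move: s0 s1; rewrite sm ler0z -[1]/(1%:~R) ler_int => m0 m1.
have : (m == 0) || (m == 1) by lia.
by case/orP=> /eqP->; [left | right].
Qed.

Lemma rounds_int (R : archiRealFieldType) (r s : R) :
  rounds r s -> r \is a Num.int -> s = r.
Proof. by move=> rs rint; apply/le_anti; have [-> // ->] := rs r rint. Qed.

Lemma binary_int (R : realType) (r : R) : binary r -> r \is a Num.int.
Proof. by case=> ->; rewrite ?rpred0 ?rpred1. Qed.

Lemma binary_itv (R : realType) (r : R) : binary r -> 0 <= r <= 1.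
Proof. by case=> ->; rewrite ?lexx ler01. Qed.

(** Up to the integer b - a, the hypothesis compares r with s, and the floor
    is monotone and commutes with adding an integer. *)
Lemma floor_difference (R : archiRealFieldType) (a b r s : R) :
  a \is a Num.int -> b \is a Num.int ->
  a + r - s <= b -> a + (Num.floor r)%:~R - (Num.floor s)%:~R <= b.
Proof.
move=> /intrP[m ->] /intrP[n ->] le_b.
have : (Num.floor r)%:~R <= s + (n - m)%:~R.
  by have := floor_le r; rewrite rmorphB /=; lra.
rewrite -lerBlDr -rmorphB /= -floor_ge_int -(ler_int R) rmorphB rmorphB /=.
by lra.
Qed.

Lemma sum_edge (R : archiRealFieldType) (V : finType) (F : V -> R) i j :
    i != j -> (forall k, k \notin [set i; j]%SET -> F k = 0) ->
  \sum_k F k = F i + F j.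
Proof.
move=> ij F0; rewrite (bigD1 i) //= (bigD1 j) /=; last by rewrite eq_sym.
rewrite big1 ?addr0 // => k /andP[ki kj].
by apply: F0; rewrite !inE negb_or ki.
Qed.

Lemma bar_arcs_edge (V : finType) (E : {set {set V}}) i j :
  [set i; j]%SET \in E -> (Some i, Some j) \in bar_arcs E.
Proof.
move=> ijE; rewrite !inE; apply/orP; left; apply/imsetP.
by exists [set i; j]%SET; rewrite //= imsetU !imset_set1.
Qed.

Lemma bar_arcs_sym (V : finType) (E : {set {set V}}) i j :
  (i, j) \in bar_arcs E -> (j, i) \in bar_arcs E.
Proof. by rewrite !inE /= finset.setUC. Qed.

Lemma bar_cardE (R : realType) (V : finType) : bar_card R V - 1 = #|V|%:R.
Proof. by rewrite /bar_card card_option -natr1 addrK. Qed.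

Section Rounding.
Variables (R : realType) (V : finType) (E : {set {set V}}).
Variables (MI : {set V}) (ML : {set {set V}}) (MP : {set V}).

Lemma IP_sub_MIP (s : Defs.point R V) :
  IP_feasible R E MI ML MP s -> MIP_feasible R E MI ML MP s.
Proof.
case: s => x y z w f u [] cs [[bx by_ bz] bw bf bu]; split=> //; split=> //.
- by split=> // [i /bx|e /by_]; apply: binary_itv.
- by move=> e i eE; apply/binary_itv/bw.
by move=> i; have [n le_n ->] := bu i; rewrite ler0n ler_nat.
Qed.

(** The rounded point keeps z and f, takes the floor of u, and takes x, y, w
    from the integral flow; the demand constraint of an edge survives because
    f_ij + f_ji is an integer. *)
Lemma MIP_rounding (cI : V -> R) (cL : {set V} -> R) (cP : V -> R)
    (s : Defs.point R V) :
    simple_graph E -> ML \subset E -> MIP_feasible R E MI ML MP s ->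
  exists2 s', IP_feasible R E MI ML MP s' &
    objective MI ML MP cI cL cP s' <= objective MI ML MP cI cL cP s.
Proof.
move=> simpleE subE; case: s => x y z w f u [].
case=> -[order ubd out1 root_in total] [cov_node cov_edge w_off load]
  [x_off y_off z_off] [[dx dy dz] dw df du].
(* The objective ignores x outside MI and y outside ML. *)
pose cx i := if i \in MI then cI i else 0.
pose cy e := if e \in ML then cL e else 0.
have [x' [y' [w' [[intx inty intw] [rx ry rw] load' cov cost]]]] :=
  integral_assignment y cx cy load.
pose u' i : R := (Num.floor (u i))%:~R.
have u'_nat i : exists2 n : nat, (n <= #|V|)%N & u' i = n%:R.
  have /andP[u0 uV] := du i; exists `|Num.floor (u i)|%N; last first.
    by rewrite /u' -[in LHS](gez0_abs (_ : 0 <= Num.floor (u i))) ?floor_ge0.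
  rewrite -lez_nat gez0_abs ?floor_ge0 //.
  by rewrite -(ler_int R); apply: le_trans uV; exact: floor_le.
have w'_off e i : e \in E -> i \notin e -> w' e i = 0.
  move=> eE ie; have w0 := w_off e i eE ie.
  by rewrite (rounds_int (rw e i eE)) w0 ?rpred0.
have fint i j : (i, j) \in bar_arcs E -> f i j \is a Num.int.
  by move=> ij; apply: binary_int; apply: df.
have shift_int n : bar_card R V - n%:R \is a Num.int.
  by apply: rpredB; exact: natr_int.
exists (Point x' y' z w' f u').
  split; split.
  - split=> //.
      move=> i j ij; apply: floor_difference (order i j ij).
        apply: rpredD; apply: rpredM; [exact: (shift_int 1%N)|exact: fint| |].
          exact: shift_int.
        exact/fint/bar_arcs_sym.
      exact: shift_int.
    move=> i; have [n le_n ->] := u'_nat i.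
    by rewrite bar_cardE ler0n ler_nat.
  - split=> //.
    move=> i j ijE; have ij : i != j.
      by have := simpleE _ ijE; rewrite cards2; case: eqP.
    have := cov [set i; j]%SET (f (Some i) (Some j) + f (Some j) (Some i)) ijE.
    rewrite !(sum_edge (i := i) (j := j)) // => [|k|k]; last 2 first.
    + exact: w'_off.
    + exact: w_off.
    rewrite !addrA; apply; last exact: cov_edge.
    have arc_ij := bar_arcs_edge ijE.
    by rewrite rpredD ?fint ?(bar_arcs_sym arc_ij).
  - split=> // [i iMI|e eE eML].
      by rewrite (rounds_int (rx i)) x_off ?rpred0.
    by rewrite (rounds_int (ry e eE)) y_off ?rpred0.
  - split=> // [i iMI|e eML]; first exact: (rounds_binary (rx i) (intx i) (dx i iMI)).
    have eE := fintype.subsetP subE e eML.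
    exact: (rounds_binary (ry e eE) (inty e) (dy e eML)).
  - by move=> e i eE; apply: (rounds_binary (rw e i eE) (intw e i) (dw e i eE)).
  - exact: df.
  - exact: u'_nat.
rewrite /objective /= lerD2r.
have sumx (h : V -> R) : \sum_(i in MI) cI i * h i = \sum_i cx i * h i.
  by rewrite big_mkcond; apply: eq_bigr => i _; rewrite /cx; case: ifP; rewrite ?mul0r.
have sumy (h : {set V} -> R) :
    \sum_(e in ML) cL e * h e = \sum_(e in E) cy e * h e.
  rewrite big_mkcond [RHS]big_mkcond; apply: eq_bigr => e _; rewrite /cy.
  case: ifP => eML; last by rewrite mul0r if_same.
  by rewrite (fintype.subsetP subE).
by rewrite !sumx !sumy.
Qed.

End Rounding.

Theorem mainTheorem5 (R : realType) (V : finType) (E : {set {set V}})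
    (MI : {set V}) (ML : {set {set V}}) (MP : {set V})
    (cI : V -> R) (cL : {set V} -> R) (cP : V -> R)
    (hE : connected_graph E) (hML : ML \subset E) :
  ((IP_feasible R E MI ML MP !=set0)%classic <->
     (MIP_feasible R E MI ML MP !=set0)%classic) /\
  optimal_value MI ML MP cI cL cP (IP_feasible R E MI ML MP) =
    optimal_value MI ML MP cI cL cP (MIP_feasible R E MI ML MP).
Proof.
have [simpleE _] := hE.
have round s := @MIP_rounding R V E MI ML MP cI cL cP s simpleE hML.
split.
  split=> [[s /IP_sub_MIP feas]|[s /round[s' feas _]]]; first by exists s.
  by exists s'.
apply/le_anti/andP; split; apply/ereal_infP => _ [s feas <-].
  have [s' feas' le_s] := round s feas.
  apply: ge_ereal_inf; exists (objective MI ML MP cI cL cP s')%:E.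
    by exists s'.
  by rewrite lee_fin.
apply: ereal_inf_lbound; exists s => //; exact: IP_sub_MIP.
Qed.
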